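(* Let $P_4$ be the path on 4 vertices. Then $W^*[P_4]=E[P_4]=3$.
   Context: Graphs are finite, simple, undirected, loopless. First-order sentences about graphs use only adjacency $\sim$ and equality $=$; the variable width of a sentence is its number of distinct variables. Write $F\sqsubset G$ if $G$ contains an induced copy of $F$. For non-isomorphic graphs $G,H$, $W(G,H)$ is the minimum variable width of a sentence true on one and false on the other; $W^*[F]=\max\{W(G,H):F\sqsubset G,\ F\not\sqsubset H\}$. For $k\ge2$, $\mathrm{EA}_k$ says: for all disjoint vertex sets $X,Y$ with $|X\cup Y|<k$ there is $z\notin X\cup Y$ adjacent to all of $X$ and to none of $Y$; $\mathrm{EA}_1$ says the graph is non-empty. The extension index $E[F]$ is the minimum $k$ such that every graph satisfying $\mathrm{EA}_k$ contains an induced copy of $F$. *)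

(* Defs.v *)
From mathcomp Require Import all_boot.

Set Implicit Arguments.
Unset Strict Implicit.
Unset Printing Implicit Defensive.

Record sgraph := SGraph {
  vertex :> finType;
  adj : rel vertex;
  adj_sym : symmetric adj;
  adj_irrefl : irreflexive adj
}.

Arguments adj {s}.

Definition path_adj n : rel 'I_n :=
  fun i j => (i.+1 == j :> nat) || (j.+1 == i :> nat).

Lemma path_adj_sym n : symmetric (@path_adj n).
Proof. by move=> i j; rewrite /path_adj orbC. Qed.

Lemma path_adj_irrefl n : irreflexive (@path_adj n).
Proof. by move=> i; rewrite /path_adj orbb (gtn_eqF (ltnSn i)). Qed.

Definition path_graph n : sgraph :=
  SGraph (@path_adj_sym n) (@path_adj_irrefl n).

Definition induced_copy (F G : sgraph) : Prop :=
  exists f : F -> G, injective f /\ forall x y, adj (f x) (f y) = adj x y.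

(* Variables are identified with natural numbers. *)
Inductive formula :=
  | FEq of nat & nat
  | FAdj of nat & nat
  | FNot of formula
  | FAnd of formula & formula
  | FOr of formula & formula
  | FExists of nat & formula
  | FForall of nat & formula.

Fixpoint vars (p : formula) : seq nat :=
  match p with
  | FEq i j | FAdj i j => [:: i; j]
  | FNot q => vars q
  | FAnd q r | FOr q r => vars q ++ vars r
  | FExists i q | FForall i q => i :: vars q
  end.

Fixpoint free_vars (p : formula) : seq nat :=
  match p with
  | FEq i j | FAdj i j => [:: i; j]
  | FNot q => free_vars q
  | FAnd q r | FOr q r => free_vars q ++ free_vars r
  | FExists i q | FForall i q => filter (predC1 i) (free_vars q)
  end.

Definition sentence (p : formula) : bool := nilp (free_vars p).

(* Distinct variables are counted, so a variable that is quantified several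
   times counts once. *)
Definition width (p : formula) : nat := size (undup (vars p)).

(* Assignments are partial so that sentences can also be evaluated on the graph
   with no vertices. Atoms with an unassigned variable are false; this never
   happens in the evaluation of a sentence. *)
Definition assign (G : sgraph) (e : nat -> option G) (i : nat) (x : G) :
    nat -> option G :=
  fun j => if j == i then Some x else e j.

Fixpoint eval (G : sgraph) (e : nat -> option G) (p : formula) : bool :=
  match p with
  | FEq i j => if (e i, e j) is (Some x, Some y) then x == y else false
  | FAdj i j => if (e i, e j) is (Some x, Some y) then adj x y else false
  | FNot q => ~~ eval e q
  | FAnd q r => eval e q && eval e r
  | FOr q r => eval e q || eval e r
  | FExists i q => [exists x : G, eval (assign e i x) q]
  | FForall i q => [forall x : G, eval (assign e i x) q]
  end.

Definition models (G : sgraph) (p : formula) : bool :=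
  eval (fun _ => None : option G) p.

Definition distinguishes (p : formula) (G H : sgraph) : Prop :=
  (models G p /\ ~~ models H p) \/ (~~ models G p /\ models H p).

Definition is_least (P : nat -> Prop) (k : nat) : Prop :=
  P k /\ forall j, P j -> k <= j.

(* W(G, H) = k *)
Definition is_W (G H : sgraph) (k : nat) : Prop :=
  is_least
    (fun w => exists p, [/\ sentence p, distinguishes p G H & width p = w]) k.

(* W*[F] = m. The upper bound includes the claim that W(G, H) is defined for
   all G and H in the range of the maximum. *)
Definition is_Wstar (F : sgraph) (m : nat) : Prop :=
  (exists G H, [/\ induced_copy F G, ~ induced_copy F H & is_W G H m]) /\
  (forall G H, induced_copy F G -> ~ induced_copy F H ->
     exists2 w, is_W G H w & w <= m).

(* The extension axiom EA_k is meant for k >= 1 only. *)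
Definition EA (k : nat) (G : sgraph) : Prop :=
  match k with
  | 1 => exists z : G, True
  | _ => forall X Y : {set G}, [disjoint X & Y] -> #|X :|: Y| < k ->
           exists z : G, [/\ z \notin X :|: Y,
                             forall x, x \in X -> adj z x
                           & forall y, y \in Y -> ~~ adj z y]
  end.

(* E[F] = k *)
Definition is_E (F : sgraph) (k : nat) : Prop :=
  is_least (fun j => 1 <= j /\ forall G, EA j G -> induced_copy F G) k.

(* Main.v *)
(** Seinsche's theorem drives both equalities: a [P_4]-free graph on at least
    two vertices splits into two nonempty parts with either all or none of the
    cross edges present.  The axiom [EA_3] forbids both kinds of split.

    For the upper bound on the width, start with the full relation on vertices
    and refine it alternately: keep only those pairs that are joined, inside
    their class, by a walk of length at most 2 in the graph (at odd steps, in
    the complement).  Every stage is definable with three variables.  In a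
    [P_4]-free graph walks of length 3 can be shortened, so every stage is
    transitive, and the splitting theorem makes the stages shrink to equality.
    If all stages are transitive, an induced [P_4] is never separated, as both
    [P_4] and its complement are connected.

    For the lower bounds, [P_4] and [2K_2] both satisfy [EA_2], and any two
    graphs satisfying [EA_2] agree on all sentences with two variables. *)

Require Import Defs.
From mathcomp Require Import all_boot.
From Stdlib Require Import Classical.

Set Implicit Arguments.
Unset Strict Implicit.
Unset Printing Implicit Defensive.

(** * Graphs without an induced path on four vertices *)

Section P4Free.

Variable T : finType.
Implicit Types (e : rel T) (C : {set T}).

Definition P4_free e := forall a b c d,
  e a b -> e b c -> e c d -> ~~ e a c -> ~~ e b d -> ~~ e a d -> False.

Definition compl e : rel T := fun x y => (x != y) && ~~ e x y.

Lemma compl_sym e : symmetric e -> symmetric (compl e).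
Proof. by move=> es x y; rewrite /compl eq_sym es. Qed.

Lemma compl_irr e : irreflexive (compl e).
Proof. by move=> x; rewrite /compl eqxx. Qed.

Lemma complK e : irreflexive e -> compl (compl e) =2 e.
Proof.
move=> ei x y; rewrite /compl negb_and !negbK.
by case: eqVneq => [->|_] //=; rewrite ei.
Qed.

(* The complement of the path a-b-c-d is the path c-a-d-b. *)
Lemma P4_free_compl e : symmetric e -> P4_free e -> P4_free (compl e).
Proof.
move=> es free a b c d ab bc cd ac bd ad.
have fs := compl_sym es.
have edge x y : x != y -> ~~ compl e x y -> e x y.
  by rewrite /compl => ->; rewrite negbK.
have nac : a != c by apply: contraNneq ad => ->.
have nbd : b != d by apply: contraNneq ad => <-.
have nad : a != d by apply: contraNneq ac => ->; rewrite fs.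
have nedge x y : compl e x y -> ~~ e x y by case/andP.
apply: (free c a d b); rewrite ?nedge // 1?fs //.
- by rewrite es edge.
- by rewrite edge.
- by rewrite es edge.
Qed.

Definition splits e C := exists A B : {set T},
  [/\ A :|: B = C, A != set0, B != set0
    & {in A & B, forall a b, compl e a b}].

Lemma splits_add e C v : symmetric e -> irreflexive e -> P4_free e ->
  v \notin C -> splits e C -> splits e (v |: C) \/ splits (compl e) (v |: C).
Proof.
move=> es ei free vC [A [B [ABC A0 B0 AB]]].
have BA : {in B & A, forall b a, compl e b a}.
  by move=> b a *; rewrite compl_sym // AB.
have nv x : x \in C -> v != x by move=> xC; apply: contraNneq vC => ->.
wlog suff extend : A B ABC A0 B0 AB BA /
    [forall a in A, ~~ e v a] -> splits e (v |: C).
  have [/extend|nA] := boolP [forall a in A, ~~ e v a].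
    by move=> /(_ B ABC A0 B0 AB BA); left.
  have [/extend|nB] := boolP [forall b in B, ~~ e v b].
    by rewrite setUC in ABC; move=> /(_ A ABC B0 A0 BA AB); left.
  have [a aA va] : exists2 a, a \in A & e v a.
    by move: nA => /forall_inPn [a aA /negbNE]; exists a.
  have [b bB vb] : exists2 b, b \in B & e v b.
    by move: nB => /forall_inPn [b bB /negbNE]; exists b.
  have nAB x y : x \in A -> y \in B -> ~~ e x y.
    by move=> xA yB; case/andP: (AB _ _ xA yB).
  have nBA x y : x \in B -> y \in A -> ~~ e x y.
    by move=> xB yA; case/andP: (BA _ _ xB yA).
  pose M := [set x in C | ~~ e v x]; pose N := [set x in C | e v x].
  have [M0|M0] := eqVneq M set0.
    right; exists [set v], C; split=> //.
    + by apply/set0Pn; exists v; rewrite inE.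
    + by apply/set0Pn; exists a; rewrite -ABC inE aA.
    + move=> _ x /set1P-> xC; rewrite complK //.
      by have /setP/(_ x) := M0; rewrite !inE xC /= => /negbFE->.
  left; exists M, (v |: N); split=> //.
  + apply/setP=> x; rewrite !inE.
    by case: (x \in C); case: (e v x); rewrite ?orbT ?orbF.
  + by apply/set0Pn; exists v; rewrite !inE eqxx.
  + move=> y x; rewrite !inE => /andP[yC nvy] /orP[/eqP->|/andP[xC vx]].
      by rewrite compl_sym // /compl nv.
    rewrite /compl (_ : y != x); last by apply: contraNneq nvy => ->.
    apply/negP; rewrite es => xy.
    move: xC yC; rewrite -ABC !inE => /orP[xA|xB] /orP[yA|yB].
    - by apply: (free b v x y); rewrite // ?nBA // es.
    - by rewrite (negbTE (nAB _ _ xA yB)) in xy.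
    - by rewrite (negbTE (nBA _ _ xB yA)) in xy.
    - by apply: (free a v x y); rewrite // ?nAB // es.
move=> /forall_inP vA; exists A, (v |: B); split=> //.
- by rewrite setUCA ABC.
- by apply/set0Pn; exists v; rewrite !inE eqxx.
- move=> a x aA; rewrite !inE => /orP[/eqP->|/AB->//].
  by rewrite compl_sym // /compl vA // nv // -ABC inE aA.
Qed.

Lemma eq_splits e f C : e =2 f -> splits e C -> splits f C.
Proof.
move=> ef [A [B [ABC A0 B0 AB]]]; exists A, B; split=> // a b aA bB.
by rewrite /compl -ef; apply: AB.
Qed.

Theorem Seinsche e C : symmetric e -> irreflexive e -> P4_free e ->
  1 < #|C| -> splits e C \/ splits (compl e) C.
Proof.
move=> es ei free; have [n] := ubnP #|C|.
elim: n C => // n IHn C; rewrite ltnS => Cn C1.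
have [v vC] : exists v, v \in C by apply/card_gt0P/ltnW.
have vC' : v \notin C :\ v by rewrite !inE eqxx.
have cC := cardsD1 v C; rewrite vC add1n in cC.
rewrite -(setD1K vC).
have [C'1|C'1] := ltnP 1 #|C :\ v|.
  case: (IHn (C :\ v) _ C'1) => [|s|s]; first by rewrite -ltnS -cC.
    exact: splits_add.
  case: (splits_add (compl_sym es) (@compl_irr e)
                     (P4_free_compl es free) vC' s); first by right.
  by left; apply: eq_splits (complK ei) _.
have /cards1P [w Cw] : #|C :\ v| == 1.
  by rewrite eqn_leq C'1 -ltnS -cC.
rewrite Cw.
have split1 f : compl f v w -> splits f (v |: [set w]).
  move=> vw; exists [set v], [set w].
  split=> //; try by apply/set0Pn; eexists; apply/set11.
  by move=> x y /set1P-> /set1P->.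
have nvw : v != w by apply: contraNneq vC' => {1}->; rewrite Cw set11.
case vw : (e v w); last by left; apply: split1; rewrite /compl vw nvw.
by right; apply: split1; rewrite complK.
Qed.

End P4Free.

Lemma induced_P4 (G : sgraph) :
  ~ induced_copy (path_graph 4) G <-> P4_free (@adj G).
Proof.
split=> [noP4 a b c d ab bc cd ac bd ad|free [f [_ fadj]]]; last first.
  apply: (free (f (inord 0)) (f (inord 1)) (f (inord 2)) (f (inord 3)));
    by rewrite fadj /= /path_adj !inordK.
apply: noP4; pose s := [:: a; b; c; d].
have sa x y : adj (nth a s (x : 'I_4)) (nth a s (y : 'I_4)) = path_adj x y.
  move: x y => [[|[|[|[|x]]]] lx] [[|[|[|[|y]]]] ly] //=;
    rewrite /path_adj /= ?adj_irrefl //;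
    by [exact/negbTE | rewrite adj_sym; first [done | exact/negbTE]].
exists (fun x : 'I_4 => nth a s x); split=> // x y /= fxy; apply/val_inj.
have same z : path_adj x z = path_adj y z by rewrite -!sa fxy.
move: (same (inord 0)) (same (inord 1)) (same (inord 2)) (same (inord 3)).
rewrite /path_adj !inordK //.
by move: x y {fxy same} => [[|[|[|[|x]]]] lx] [[|[|[|[|y]]]] ly].
Qed.

(** * The refinement and its definition with three variables *)

Section Refinement.

Variable G : sgraph.
Implicit Types (b : bool) (n : nat) (x y z : G).

Definition step b : rel G := if b then compl adj else adj.

Definition rstep b : rel G := fun x y => (x == y) || step b x y.

Fixpoint refine n : rel G := fun x y =>
  if n is m.+1 then
    refine m x y &&
      [exists z, refine m x z && (rstep (odd m) x z && rstep (odd m) z y)]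
  else true.

Lemma step_sym b : symmetric (step b).
Proof. by case: b; [apply/compl_sym|]; apply: adj_sym. Qed.

Lemma step_irr b : irreflexive (step b).
Proof. by case: b; [apply: compl_irr|apply: adj_irrefl]. Qed.

Lemma rstep_sym b : symmetric (rstep b).
Proof. by move=> x y; rewrite /rstep eq_sym step_sym. Qed.

Lemma refine_refl n : reflexive (refine n).
Proof.
elim: n => //= n IHn x; rewrite IHn; apply/existsP; exists x.
by rewrite IHn /rstep eqxx.
Qed.

Lemma refine_step n x y :
  refine n x y -> step (odd n) x y -> refine n.+1 x y.
Proof.
move=> xy sxy; rewrite /= xy; apply/existsP; exists x.
by rewrite refine_refl /rstep eqxx sxy orbT.
Qed.

Lemma refineS n x y : refine n.+1 x y = refine n x y &&
  [exists z, refine n x z && (rstep (odd n) x z && rstep (odd n) z y)].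
Proof. by []. Qed.

Lemma refine_sub n x y : refine n.+1 x y -> refine n x y.
Proof. by rewrite refineS => /andP[]. Qed.

Lemma refine_sym n : (forall m, m < n -> transitive (refine m)) ->
  symmetric (refine n).
Proof.
elim: n => // n IHn tr.
have sym : symmetric (refine n) by apply: IHn => m mn; apply/tr/ltnW.
have half x y : refine n.+1 x y -> refine n.+1 y x.
  rewrite refineS => /andP[xy /existsP[z /and3P[xz sxz szy]]].
  rewrite refineS sym xy; apply/existsP; exists z.
  rewrite (rstep_sym _ y) szy rstep_sym sxz !andbT.
  by apply: (tr n (leqnn _) x) => //; rewrite sym.
by move=> x y; apply/idP/idP; apply: half.
Qed.

Section Free.

Hypothesis free : P4_free (@adj G).

Lemma step_free b : P4_free (step b).
Proof. by case: b => //; apply: P4_free_compl => //; apply: adj_sym. Qed.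

Lemma refine_trans n : transitive (refine n).
Proof.
suff: forall m, m <= n -> transitive (refine m) by apply.
elim: n => [|n IHn] m; first by rewrite leqn0 => /eqP->.
rewrite leq_eqVlt => /predU1P[->|]; last exact: IHn.
have tr : transitive (refine n) by apply: IHn.
have sym : symmetric (refine n) by apply: refine_sym => k /ltnW/IHn.
have short x y z : refine n.+1 x y -> refine n y z -> rstep (odd n) y z ->
    refine n.+1 x z.
  rewrite refineS => /andP[xy /existsP[w /and3P[xw sxw swy]]] yz syz.
  have xz : refine n x z by apply: tr yz.
  have via u : refine n x u -> rstep (odd n) x u -> rstep (odd n) u z ->
      refine n.+1 x z.
    move=> xu s1 s2; rewrite refineS xz; apply/existsP; exists u.
    by rewrite xu s1.
  have [s|nxz] := boolP (rstep (odd n) x z).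
    by apply: (via x); rewrite ?refine_refl // /rstep eqxx.
  have [s|nxy] := boolP (rstep (odd n) x y); first exact: (via y).
  have [s|nwz] := boolP (rstep (odd n) w z); first exact: (via w).
  move: sxw swy syz; rewrite /rstep => /predU1P[xw'|sxw].
    by rewrite xw' in nxy * => /idP; rewrite -/(rstep _ _ _) (negbTE nxy).
  move=> /predU1P[wy|swy].
    by move: nxy; rewrite -wy /rstep sxw orbT.
  move=> /predU1P[yz'|syz].
    by move: nwz; rewrite -yz' /rstep swy orbT.
  move: nxz nxy nwz; rewrite /rstep !negb_or.
  move=> /andP[_ nxz] /andP[_ nxy] /andP[_ nwz].
  by case: (step_free sxw swy syz nxy nwz nxz).
move=> y x z xy; rewrite [refine _ y z]refineS.
move=> /andP[yz /existsP[w /and3P[yw syw swz]]].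
apply: (short _ w) => //; first exact: (short _ y).
by apply: tr yz; rewrite sym.
Qed.

Lemma splits_refine n x (C : {set G}) : (forall y, (y \in C) = refine n x y) ->
  {in C &, forall y z, refine n.+1 y z} -> ~ splits (step (odd n)) C.
Proof.
move=> Cx conn [A [B [ABC /set0Pn[a aA] /set0Pn[b bB] AB]]].
have aC : a \in C by rewrite -ABC inE aA.
have bC : b \in C by rewrite -ABC inE bB orbT.
have nAB y z : y \in A -> z \in B -> ~~ rstep (odd n) y z.
  by move=> yA zB; rewrite /rstep negb_or; apply: AB.
have := conn _ _ aC bC.
rewrite refineS => /andP[_ /existsP[w /and3P[aw saw swb]]].
have : w \in C by rewrite Cx; apply: refine_trans aw; rewrite -Cx.
rewrite -ABC inE => /orP[wA|wB].
  by rewrite (negbTE (nAB _ _ wA bB)) in swb.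
by rewrite (negbTE (nAB _ _ aA wB)) in saw.
Qed.

Lemma refine_shrinks n x y : x != y -> refine n x y ->
  exists p q, refine n p q && ~~ refine n.+2 p q.
Proof.
move=> nxy xy; apply: NNPP => stable.
have sym : symmetric (refine n) by apply: refine_sym => *; apply: refine_trans.
have st2 p q : refine n p q -> refine n.+2 p q.
  move=> pq; apply/negPn/negP => npq; apply: stable.
  by exists p, q; rewrite pq npq.
have st1 p q : refine n.+1 p q = refine n p q.
  by apply/idP/idP => [/refine_sub|/st2/refine_sub].
pose C := [set z | refine n x z].
have inC z : (z \in C) = refine n x z by rewrite inE.
have inC1 z : (z \in C) = refine n.+1 x z by rewrite inC st1.
have conn : {in C &, forall y z, refine n y z}.
  by move=> p q; rewrite !inC sym => xp xq; apply: refine_trans xq.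
have C1 : 1 < #|C|.
  rewrite (cardD1 x) (cardD1 y) !inE refine_refl /= xy eq_sym nxy /=.
  by [].
have [] := Seinsche (@step_sym (odd n)) (@step_irr (odd n))
             (@step_free (odd n)) C1.
  apply: splits_refine inC _ => p q pC qC; rewrite st1; exact: conn.
have eqs : compl (step (odd n)) =2 step (odd n.+1).
  move=> p q; rewrite /step /=; case: (odd n) => //=.
  by rewrite complK //; apply: adj_irrefl.
move/(eq_splits eqs); apply: splits_refine inC1 _ => p q pC qC.
by apply: st2; apply: conn.
Qed.

Lemma refine_eventually_trivial :
  exists n, forall x y, refine n x y -> x = y.
Proof.
suff: forall k n, #|[set p | refine n p.1 p.2]| < k ->
    exists n, forall x y, refine n x y -> x = y.
  by move/(_ _ 0 (ltnSn _)).
elim=> // k IHk n; rewrite ltnS => le_k.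
have [triv|/forallPn[x /forallPn[y]]] :=
  boolP [forall x, forall y, refine n x y ==> (x == y)].
  exists n => x y xy; apply/eqP; move/forallP: triv => /(_ x)/forallP/(_ y).
  by rewrite xy.
rewrite negb_imply => /andP[xy nxy].
have [p [q /andP[pq npq]]] := refine_shrinks nxy xy.
apply: (IHk n.+2); apply: leq_trans le_k; apply: proper_card.
apply/properP; split; last by exists (p, q); rewrite inE.
by apply/subsetP=> r; rewrite !inE => /refine_sub/refine_sub.
Qed.

End Free.

Lemma refine_P4 n (a b c d : G) :
  (forall m, m <= n -> transitive (refine m)) ->
  adj a b -> adj b c -> adj c d -> ~~ adj a c -> ~~ adj b d -> ~~ adj a d ->
  {in [:: a; b; c; d] &, forall p q, refine n p q}.
Proof.
move=> tr ab bc cd ac bd ad; elim: n tr => // n IHn tr.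
have trS : transitive (refine n.+1) by apply: tr.
have symS : symmetric (refine n.+1) by apply: refine_sym => m /ltnW/tr.
have {}IHn := IHn (fun m mn => tr m (leqW mn)).
have nac : a != c by apply: contraNneq ad => ->.
have nbd : b != d by apply: contraNneq ad => <-.
have nad : a != d by apply: contraNneq ac => ->; rewrite adj_sym.
have up p q : p \in [:: a; b; c; d] -> q \in [:: a; b; c; d] ->
    step (odd n) p q -> refine n.+1 p q.
  by move=> pP qP; apply: refine_step; apply: IHn.
suff from_a : {in [:: a; b; c; d], forall p, refine n.+1 a p}.
  by move=> p q /from_a ap /from_a; apply: trS; rewrite symS.
move: up; case: (odd n) => up.
- have co p q : p \in [:: a; b; c; d] -> q \in [:: a; b; c; d] ->
      p != q -> ~~ adj p q -> refine n.+1 p q.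
    by move=> pP qP npq pq; apply: up; rewrite // /step /compl npq.
  have rac : refine n.+1 a c by apply: co; rewrite // !inE eqxx ?orbT.
  have rad : refine n.+1 a d by apply: co; rewrite // !inE eqxx ?orbT.
  have rdb : refine n.+1 d b.
    by rewrite symS; apply: co; rewrite // !inE eqxx ?orbT.
  have rab := trS _ _ _ rad rdb.
  by move=> p; rewrite !inE => /or4P[]/eqP-> //; apply: refine_refl.
- have rab : refine n.+1 a b by apply: up; rewrite ?inE ?eqxx ?orbT.
  have rbc : refine n.+1 b c by apply: up; rewrite ?inE ?eqxx ?orbT.
  have rcd : refine n.+1 c d by apply: up; rewrite ?inE ?eqxx ?orbT.
  have rac := trS _ _ _ rab rbc; have rad := trS _ _ _ rac rcd.
  by move=> p; rewrite !inE => /or4P[]/eqP-> //; apply: refine_refl.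
Qed.

End Refinement.

Definition step_formula b x y : formula :=
  if b then FNot (FAdj x y) else FOr (FEq x y) (FAdj x y).

(* The variable [z] serves as workspace: it is neither free in the formula nor
   expected to be assigned. *)
Fixpoint refine_formula n x y z : formula :=
  if n is m.+1 then
    FAnd (refine_formula m x y z)
      (FExists z (FAnd (refine_formula m x z y)
        (FAnd (step_formula (odd m) x z) (step_formula (odd m) z y))))
  else FOr (FEq x y) (FNot (FEq x y)).

Definition trans_formula n : formula :=
  FForall 0 (FForall 1 (FForall 2
    (FOr (FNot (refine_formula n 0 1 2))
      (FOr (FNot (refine_formula n 1 2 0)) (refine_formula n 0 2 1))))).

Definition trivial_formula n : formula :=
  FForall 0 (FForall 1 (FOr (FNot (refine_formula n 0 1 2)) (FEq 0 1))).

Definition cograph_formula n : formula :=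
  foldr (fun m p => FAnd (trans_formula m) p) (trivial_formula n)
    (iota 0 n.+1).

Section Evaluation.

Variable G : sgraph.
Implicit Types (e : nat -> option G).

Lemma eval_step e b x y u v : e x = Some u -> e y = Some v ->
  eval e (step_formula b x y) = rstep b u v.
Proof.
move=> ex ey; rewrite /step_formula /rstep /step.
case: b => /=; rewrite ex ey // /compl.
by case: eqVneq => [->|_] //=; rewrite adj_irrefl.
Qed.

Lemma eval_refine n e x y z u v : uniq [:: x; y; z] ->
  e x = Some u -> e y = Some v ->
  eval e (refine_formula n x y z) = refine n u v.
Proof.
elim: n e x y z u v => [|n IHn] e x y z u v /= xyz ex ey.
  by rewrite ex ey orbN.
move: (xyz); rewrite !inE andbT negb_or => /andP[/andP[nxy nxz] nyz].
rewrite (IHn _ _ _ _ u v) //=; congr (_ && _); apply: eq_existsb => w.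
have exz : assign e z w x = Some u by rewrite /assign (negbTE nxz).
have eyz : assign e z w y = Some v by rewrite /assign (negbTE nyz).
have ezz : assign e z w z = Some w by rewrite /assign eqxx.
rewrite (IHn _ _ _ _ u w) //; last first.
  by rewrite /= !inE negb_or nxy nxz eq_sym nyz.
by rewrite (eval_step _ exz ezz) (eval_step _ ezz eyz).
Qed.

Lemma models_trans n : reflect (transitive (@refine G n))
  (models G (trans_formula n)).
Proof.
have -> : models G (trans_formula n) =
    [forall u : G, forall v : G, forall w : G,
       refine n u v ==> refine n v w ==> refine n u w].
  rewrite /models /=.
  apply: eq_forallb => u; apply: eq_forallb => v; apply: eq_forallb => w.
  rewrite (@eval_refine _ _ 0 1 2 u v) // (@eval_refine _ _ 1 2 0 v w) //.
  by rewrite (@eval_refine _ _ 0 2 1 u w) // !implybE.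
apply: (iffP forallP) => [tr v u w uv vw|tr u].
  by move/forallP: (tr u) => /(_ v)/forallP/(_ w); rewrite uv vw.
apply/forallP=> v; apply/forallP=> w.
by apply/implyP=> uv; apply/implyP; apply: tr.
Qed.

Lemma models_trivial n : reflect (forall x y : G, refine n x y -> x = y)
  (models G (trivial_formula n)).
Proof.
have -> : models G (trivial_formula n) =
    [forall u : G, forall v : G, refine n u v ==> (u == v)].
  rewrite /models /=; apply: eq_forallb => u; apply: eq_forallb => v.
  by rewrite (@eval_refine _ _ 0 1 2 u v) // implybE.
apply: (iffP forallP) => [tr u v uv|tr u].
  by move/forallP: (tr u) => /(_ v); rewrite uv => /eqP.
by apply/forallP=> v; apply/implyP=> /tr->.
Qed.

Lemma models_cograph n : reflect
  ((forall m, m <= n -> transitive (@refine G m)) /\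
   (forall x y : G, refine n x y -> x = y))
  (models G (cograph_formula n)).
Proof.
have -> : models G (cograph_formula n) =
    all (fun m => models G (trans_formula m)) (iota 0 n.+1)
    && models G (trivial_formula n).
  rewrite /cograph_formula; elim: (iota 0 n.+1) => //= m s IHs.
  by rewrite -andbA -IHs.
apply: (iffP andP) => [[/allP tr /models_trivial tv]|[tr tv]]; split=> //.
- by move=> m mn; apply/models_trans/tr; rewrite mem_iota.
- by apply/allP=> m; rewrite mem_iota => /tr/models_trans.
- exact/models_trivial.
Qed.

End Evaluation.

Lemma free_vars_refine n x y z :
  {subset free_vars (refine_formula n x y z) <= [:: x; y]}.
Proof.
have sub b u v : {subset free_vars (step_formula b u v) <= [:: u; v]}.
  by case: b => //= w; rewrite !inE; do !case: eqP.
elim: n x y z => [|n IHn] x y z w /=; first by rewrite !inE; do !case: eqP.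
rewrite mem_cat mem_filter !mem_cat => /orP[/IHn//|/andP[/= nwz]].
case/or3P=> [/IHn|/sub|/sub]; rewrite !inE (negbTE nwz) ?orbF ?orFb => -> //.
by rewrite orbT.
Qed.

Lemma vars_refine n x y z :
  {subset vars (refine_formula n x y z) <= [:: x; y; z]}.
Proof.
have sub b u v : {subset vars (step_formula b u v) <= [:: u; v]}.
  by case: b => //= w; rewrite !inE; do !case: eqP.
elim: n x y z => [|n IHn] x y z w /=.
  by rewrite !inE; do !case: eqP.
rewrite mem_cat !inE !mem_cat.
case/or4P=> [/IHn|->|/IHn|/orP[/sub|/sub]]; rewrite ?inE ?orbT //.
all: by do !case: eqP.
Qed.

Lemma sentence_cograph n : sentence (cograph_formula n).
Proof.
rewrite /sentence /cograph_formula.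
have nilP s : (forall w : nat, w \notin s) -> s = [::].
  by case: s => // w s /(_ w); rewrite inE eqxx.
have tr m : free_vars (trans_formula m) = [::].
  apply: nilP => w; rewrite /= !mem_filter !mem_cat /=; apply/negP.
  case/and4P=> w0 w1 w2.
  by case/or3P=> /free_vars_refine;
    rewrite !inE ?(negbTE w0) ?(negbTE w1) ?(negbTE w2).
have tv : free_vars (trivial_formula n) = [::].
  apply: nilP => w; rewrite /= !mem_filter !mem_cat /=; apply/negP.
  case/and3P=> w0 w1 /orP[/free_vars_refine|];
  by rewrite !inE (negbTE w0) (negbTE w1).
pose F := foldr (fun m p => FAnd (trans_formula m) p) (trivial_formula n).
rewrite -/(F _); elim: (iota 0 n.+1) => [|m s IHs]; first by rewrite [F _]/= tv.
have -> : free_vars (F (m :: s)) = free_vars (trans_formula m) ++ free_vars (F s).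
  by [].
by rewrite tr.
Qed.

Lemma width_cograph n : width (cograph_formula n) <= 3.
Proof.
rewrite /width (uniq_leq_size (s2 := [:: 0; 1; 2])) ?undup_uniq //.
have sub m x y z : perm_eq [:: x; y; z] [:: 0; 1; 2] ->
    {subset vars (refine_formula m x y z) <= [:: 0; 1; 2]}.
  by move=> /perm_mem xyz w /vars_refine; rewrite xyz.
have small k : k <= 2 -> k \in [:: 0; 1; 2] by case: k => [|[|[|k]]].
move=> w; rewrite mem_undup /cograph_formula.
elim: (iota 0 n.+1) => [|m s IHs].
  move=> /= wV; rewrite !(in_cons, mem_cat) in_nil orbF in wV.
  by case/or4P: wV => [/eqP->|/eqP->|/sub->|/orP[]/eqP->] //; apply: small.
have -> : vars (foldr (fun m p => FAnd (trans_formula m) p)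
                  (trivial_formula n) (m :: s)) =
  [:: 0, 1, 2 & vars (refine_formula m 0 1 2) ++
     (vars (refine_formula m 1 2 0) ++ vars (refine_formula m 0 2 1))] ++
  vars (foldr (fun m p => FAnd (trans_formula m) p) (trivial_formula n) s).
  by [].
move=> wV; rewrite !(in_cons, mem_cat) -!orbA in wV.
case/or4P: wV => [/eqP->|/eqP->|/eqP->|]; try exact: small.
by case/or4P=> [/sub->|/sub->|/sub->|/IHs].
Qed.

(** * The axiom [EA_2] and sentences with two variables *)

Definition extendible (G : sgraph) :=
  [/\ exists x : G, True, forall x : G, exists y, adj x y
    & forall x : G, exists2 y, x != y & ~~ adj x y].

Lemma extendible_EA2 G : extendible G -> EA 2 G.
Proof.
case=> [[x0 _] nb co] X Y disj; rewrite ltnS => /card_le1P XY.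
have [XY0|/set0Pn[w wXY]] := eqVneq (X :|: Y) set0.
  have out x : (x \in X :|: Y) = false by rewrite XY0 inE.
  exists x0; split=> [|x xX|x xY]; first by rewrite out.
    by have := out x; rewrite inE xX.
  by have := out x; rewrite inE xY orbT.
have eqw x : x \in X :|: Y -> x = w by rewrite (XY _ wXY) => /eqP.
have subX x : x \in X -> x \in X :|: Y by rewrite inE => ->.
have subY x : x \in Y -> x \in X :|: Y by rewrite inE orbC => ->.
move: wXY; rewrite inE => /orP[wX|wY].
  have [z wz] := nb w; exists z; split=> [|x /subX/eqw->|x xY].
  - by apply: contraTN wz => /eqw->; rewrite adj_irrefl.
  - by rewrite adj_sym.
  - by have xw := eqw _ (subY _ xY); rewrite xw (disjointFr disj wX) in xY.
have [z nwz wz] := co w; exists z; split=> [|x xX|x /subY/eqw->].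
- by apply: contraNN nwz => /eqw->.
- by have xw := eqw _ (subX _ xX); rewrite xw (disjointFl disj wY) in xX.
- by rewrite adj_sym.
Qed.

Definition same_type (G H : sgraph) (V : seq nat)
    (e : nat -> option G) (f : nat -> option H) :=
  {in V &, forall k l, eval e (FEq k l) = eval f (FEq k l) /\
                       eval e (FAdj k l) = eval f (FAdj k l)}.

Lemma same_type_sym (G H : sgraph) V (e : nat -> option G) (f : nat -> option H) :
  same_type V e f -> same_type V f e.
Proof. by move=> st k l kV lV; have [-> ->] := st k l kV lV. Qed.

Lemma same_type_assign (G H : sgraph) (V : seq nat) i
    (e : nat -> option G) (f : nat -> option H) (x : G) :
  extendible H -> uniq V -> size V <= 2 -> i \in V -> same_type V e f ->
  exists y : H, same_type V (assign e i x) (assign f i y).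
Proof.
move=> [[y0 _] nb co] Vu V2 iV st.
suff [y xy] : exists y : H, {in V, forall k, k != i ->
    match e k, f k with
    | Some u, Some v => (x == u) = (y == v) /\ adj x u = adj y v
    | None, None => True
    | _, _ => False
    end}.
  exists y => k l kV lV; rewrite /= /assign.
  have := xy k kV; have := xy l lV.
  have [->|nk] := eqVneq k i; have [->|nl] := eqVneq l i.
  - by rewrite !eqxx !adj_irrefl.
  - by move=> /(_ isT); case: (e l) => [u|]; case: (f l) => [v|] // [].
  - move=> _ /(_ isT); case: (e k) => [u|]; case: (f k) => [v|] //.
    by rewrite ![_ == x]eq_sym ![_ == y]eq_sym !(adj_sym _ x) !(adj_sym _ y).
  - by move=> _ _; apply: st.
have [/hasP[k kV /= nk]|/hasPn no] := boolP (has (predC1 i) V); last first.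
  by exists y0 => k /no /=; rewrite negbK => ->.
have only l : l \in V -> l != i -> l = k.
  move=> lV nl; apply/eqP/negPn/negP => nlk.
  have : size [:: i; k; l] <= size V.
    apply: uniq_leq_size => [|m]; last by rewrite !inE => /or3P[]/eqP->.
    by rewrite /= !inE negb_or !(eq_sym i) nk nl eq_sym nlk.
  by rewrite /= leqNgt ltnS V2.
suff [y yP] : exists y : H, match e k, f k with
    | Some u, Some v => (x == u) = (y == v) /\ adj x u = adj y v
    | None, None => True
    | _, _ => False
    end.
  by exists y => l lV /(only _ lV) ->.
have [] := st k k kV kV; rewrite /=.
case: (e k) => [u|]; case: (f k) => [v|]; rewrite ?eqxx // => _ _.
have [->|nxu] := eqVneq x u.
  by exists v; rewrite !adj_irrefl eqxx.
case xu : (adj x u).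
  have [y vy] := nb v; exists y; rewrite adj_sym vy; split=> //.
  by apply/esym/negbTE; apply: contraTneq vy => ->; rewrite adj_irrefl.
have [y nvy vy] := co v; exists y; rewrite adj_sym (negbTE vy); split=> //.
by rewrite eq_sym (negbTE nvy).
Qed.

Lemma eval_same_type (G H : sgraph) V (e : nat -> option G) (f : nat -> option H) p :
  extendible G -> extendible H -> uniq V -> size V <= 2 ->
  {subset vars p <= V} -> same_type V e f -> eval e p = eval f p.
Proof.
move=> eG eH Vu V2; elim: p e f => [i j|i j|q IHq|q IHq r IHr|q IHq r IHr
                                   |i q IHq|i q IHq] e f sub st.
- by have [] := st i j (sub i _) (sub j _); rewrite ?inE ?eqxx ?orbT.
- by have [] := st i j (sub i _) (sub j _); rewrite ?inE ?eqxx ?orbT.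
- by rewrite /= (IHq e f).
- by rewrite /= (IHq e f) ?(IHr e f) // => k kq; apply: sub;
    rewrite mem_cat kq ?orbT.
- by rewrite /= (IHq e f) ?(IHr e f) // => k kq; apply: sub;
    rewrite mem_cat kq ?orbT.
- have iV : i \in V by apply: sub; rewrite inE eqxx.
  have subq : {subset vars q <= V}.
    by move=> k kq; apply: sub; rewrite inE kq orbT.
  rewrite /=; apply/existsP/existsP => [[x]|[y]].
    have [y xy] := same_type_assign x eH Vu V2 iV st.
    by rewrite (IHq _ _ subq xy); exists y.
  have [x /same_type_sym xy] := same_type_assign y eG Vu V2 iV (same_type_sym st).
  by rewrite -(IHq _ _ subq xy); exists x.
- have iV : i \in V by apply: sub; rewrite inE eqxx.
  have subq : {subset vars q <= V}.
    by move=> k kq; apply: sub; rewrite inE kq orbT.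
  rewrite /=; apply/forallP/forallP => [all y|all x].
    have [x /same_type_sym xy] :=
      same_type_assign y eG Vu V2 iV (same_type_sym st).
    by rewrite -(IHq _ _ subq xy).
  have [y xy] := same_type_assign x eH Vu V2 iV st.
  by rewrite (IHq _ _ subq xy).
Qed.

Lemma extendible_distinguishes G H p : extendible G -> extendible H ->
  distinguishes p G H -> 2 < width p.
Proof.
move=> eG eH dist; rewrite ltnNge; apply/negP => w2.
have : models G p = models H p.
  apply: (@eval_same_type _ _ (undup (vars p))) => //.
  - exact: undup_uniq.
  - by move=> k; rewrite mem_undup.
by move=> eqp; case: dist; rewrite eqp => -[]; case: (models H p).
Qed.

Definition two_K2_adj : rel (bool * bool) :=
  fun x y => (x.1 == y.1) && (x.2 != y.2).

Lemma two_K2_sym : symmetric two_K2_adj.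
Proof. by move=> x y; rewrite /two_K2_adj eq_sym (eq_sym x.2). Qed.

Lemma two_K2_irrefl : irreflexive two_K2_adj.
Proof. by move=> x; rewrite /two_K2_adj !eqxx. Qed.

Definition two_K2 : sgraph := SGraph two_K2_sym two_K2_irrefl.

Lemma extendible_two_K2 : extendible two_K2.
Proof.
split; first by exists (true, true).
- by move=> [a b]; exists (a, ~~ b); case: a b => [] [].
- by move=> [a b]; exists (~~ a, b); case: a b => [] [].
Qed.

Lemma extendible_P4 : extendible (path_graph 4).
Proof.
split; first by exists ord0.
- case=> [[|[|[|[|x]]]] lx] //;
    [exists (inord 1) | exists (inord 0) | exists (inord 1) | exists (inord 2)];
    by rewrite /adj /= /path_adj inordK.
- case=> [[|[|[|[|x]]]] lx] //;
    [exists (inord 2) | exists (inord 3) | exists (inord 0) | exists (inord 1)];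
    by rewrite ?/adj /= /path_adj -?val_eqE /= inordK.
Qed.

Lemma two_K2_P4_free : P4_free (@adj two_K2).
Proof. by move=> [[] []] [[] []] [[] []] [[] []]. Qed.

(** * The two parameters of the path *)

Lemma EA3_P4 G : EA 3 G -> induced_copy (path_graph 4) G.
Proof.
move=> ea; apply: NNPP => /induced_P4 free.
have side (A B : {set G}) z : A :|: B = setT -> z \in A \/ z \in B.
  by move=> AB; apply/setUP; rewrite AB inE.
have card2 (x y : G) : #|[set x; y]| < 3 by rewrite cards2; case: eqP.
have [v _] : exists v : G, True.
  have [||z _] := ea set0 set0; first by rewrite -setI_eq0 setI0.
    by rewrite setU0 cards0.
  by exists z.
have [] := Seinsche (C := setT) (@adj_sym G) (@adj_irrefl G) free.
- have [||z [zv _ _]] := ea [set v; v] set0.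
  + by rewrite -setI_eq0 setI0.
  + by rewrite setU0.
  rewrite (cardD1 v) (cardD1 z) !inE /=; move: zv.
  by rewrite !inE orbb orbF => ->.
- case=> A [B [AB /set0Pn[a aA] /set0Pn[b bB] cAB]].
  have [||z [_ adjz _]] := ea [set a; b] set0.
  + by rewrite -setI_eq0 setI0.
  + by rewrite setU0.
  have za := adjz a (set21 _ _); have zb := adjz b (set22 _ _).
  case: (side A B z AB) => [zA|zB].
    by have /andP[_] := cAB _ _ zA bB; rewrite zb.
  by have /andP[_] := cAB _ _ aA zB; rewrite adj_sym za.
- case=> A [B [AB /set0Pn[a aA] /set0Pn[b bB] cAB]].
  have [||z [zab _ adjz]] := ea set0 [set a; b].
  + by rewrite -setI_eq0 set0I.
  + by rewrite set0U.
  have za := adjz a (set21 _ _); have zb := adjz b (set22 _ _).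
  case: (side A B z AB) => [zA|zB].
    by have := cAB _ _ zA bB; rewrite complK ?(negbTE zb) //; apply: adj_irrefl.
  have := cAB _ _ aA zB; rewrite complK; last exact: adj_irrefl.
  by rewrite adj_sym (negbTE za).
Qed.

Lemma cograph_formula_distinguishes G H :
  induced_copy (path_graph 4) G -> ~ induced_copy (path_graph 4) H ->
  exists n, distinguishes (cograph_formula n) G H.
Proof.
move=> GP4 /induced_P4 freeH.
have [n triv] := refine_eventually_trivial freeH.
exists n; right; split; last first.
  by apply/models_cograph; split=> // m _; apply: refine_trans.
apply/models_cograph => -[tr trivG].
apply: (proj2 (induced_P4 G) _ GP4) => a b c d ab bc cd ac bd ad.
have : refine n a b by apply: (refine_P4 tr ab bc cd ac bd ad);
  rewrite !inE eqxx ?orbT.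
by move/trivG=> eab; rewrite eab adj_irrefl in ab.
Qed.

Lemma exists_least (P : nat -> Prop) n : P n -> exists2 k, is_least P k & k <= n.
Proof.
have [m] := ubnP n; elim: m n => // m IHm n nm Pn.
have [[j Pj jn]|least] := classic (exists2 j, P j & j < n).
  have [k lk kj] := IHm j (leq_trans jn nm) Pj.
  by exists k => //; apply: leq_trans kj (ltnW jn).
exists n => //; split=> // j Pj; rewrite leqNgt; apply/negP => jn.
by apply: least; exists j.
Qed.

Lemma W_le3 G H :
  induced_copy (path_graph 4) G -> ~ induced_copy (path_graph 4) H ->
  exists2 w, is_W G H w & w <= 3.
Proof.
move=> GP4 HP4; have [n dist] := cograph_formula_distinguishes GP4 HP4.
have [|k lk kw] := @exists_least (fun w => exists p,
    [/\ sentence p, distinguishes p G H & width p = w]) (width (cograph_formula n)).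
  by exists (cograph_formula n); split=> //; apply: sentence_cograph.
by exists k => //; apply: leq_trans kw (width_cograph n).
Qed.

Theorem theorem4p3 :
  is_Wstar (path_graph 4) 3 /\ is_E (path_graph 4) 3.
Proof.
have P4P4 : induced_copy (path_graph 4) (path_graph 4).
  by exists id; split=> // x y.
have noP4 : ~ induced_copy (path_graph 4) two_K2.
  exact/induced_P4/two_K2_P4_free.
split; split.
- exists (path_graph 4), two_K2; split=> //.
  have [w W w3] := W_le3 P4P4 noP4; suff ew : w = 3 by rewrite ew in W.
  apply/eqP; rewrite eqn_leq w3; have [[p [_ dist <-]] _] := W.
  exact: (extendible_distinguishes extendible_P4 extendible_two_K2 dist).
- exact: W_le3.
- by split=> // G; apply: EA3_P4.
- case=> [|[|[|j]]] [j0 eaj] //; case: noP4; apply: eaj.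
    by exists (true, true).
  exact: (extendible_EA2 extendible_two_K2).
Qed.
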